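(* Given $d\in\mathbb{N}$, $\alpha>0$ and $\delta>0$, there is an $M\in\mathbb{N}$ (depending only on $d,\alpha,\delta$) with the following property. If $E\subset[0,1]^d$, then there are sets $F_1,F_2,\dots,F_M,Z\subset E$ such that: (1) $E=F_1\cup F_2\cup\cdots\cup F_M\cup Z$; (2) $\lambda(Z)<\alpha$; (3) for each $i\in\{1,2,\dots,M\}$, $F_i$ is $\delta$-well-connected in $E$.
   Context: $\lambda$ denotes Lebesgue measure on $\mathbb{R}^d$. The set $E$ is not assumed measurable; if $E$ is not measurable, conclusion (2) is interpreted in the sense of Lebesgue outer measure. $|\cdot|$ is the Euclidean norm. Given $\eta$, an $\eta$-chain is a finite list of points $(x_0,\dots,x_m)$ (with $m\ge 0$) such that $|x_i-x_{i+1}|<\eta$ for each $i\in\{0,\dots,m-1\}$. It is from $x$ to $y$ if $x=x_0$ and $y=x_m$; it is in $E$ if all its points lie in $E$. Its length is $\sum_{i=0}^{m-1}|x_i-x_{i+1}|$. For $F\subset E\subset[0,1]^d$, $F$ is $\delta$-well-connected in $E$ if for every $x,y\in F$ there is a $\delta|x-y|$-chain from $x$ to $y$ in $E$ with length at most $(1+\delta)|x-y|$. (For $x=y$ the one-point list $(x)$ serves as such a chain.) *)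

(* Defs.v *)
From HB Require Import structures.
From mathcomp Require Import all_boot all_order all_algebra.
From mathcomp Require Import all_classical all_reals all_analysis.

Set Implicit Arguments.
Unset Strict Implicit.
Unset Printing Implicit Defensive.

Import Order.TTheory GRing.Theory Num.Theory.

Local Open Scope classical_set_scope.
Local Open Scope ring_scope.

(* The library norm on ['rV[R]_d] is the sup norm, hence this definition. *)
Definition eucl_norm {R : realType} {d : nat} (v : 'rV[R]_d) : R :=
  Num.sqrt (\sum_(i < d) v ord0 i ^+ 2).

Definition unit_cube {R : realType} {d : nat} : set 'rV[R]_d :=
  [set x | forall i, 0 <= x ord0 i <= 1].

(* The chain (x_0, ..., x_m) is encoded by its head x_0 and its tail
   s = [:: x_1; ...; x_m]. *)
Definition chain_from_to_in {R : realType} {d : nat}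
    (eta : R) (x y : 'rV[R]_d) (E : set 'rV[R]_d) (s : seq 'rV[R]_d) : Prop :=
  [/\ path (fun u v => eucl_norm (u - v) < eta) x s,
      last x s = y &
      forall z, z \in x :: s -> E z].

Definition chain_length {R : realType} {d : nat}
    (x : 'rV[R]_d) (s : seq 'rV[R]_d) : R :=
  \sum_(i < size s) eucl_norm (nth 0 (x :: s) i - nth 0 (x :: s) i.+1).

Definition well_connected {R : realType} {d : nat}
    (delta : R) (F E : set 'rV[R]_d) : Prop :=
  forall x y, F x -> F y ->
    exists s : seq 'rV[R]_d,
      chain_from_to_in (delta * eucl_norm (x - y)) x y E s /\
      chain_length x s <= (1 + delta) * eucl_norm (x - y).

Definition box {R : realType} {d : nat} (a b : 'rV[R]_d) : set 'rV[R]_d :=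
  [set x | forall i, a ord0 i < x ord0 i <= b ord0 i].

Definition box_volume {R : realType} {d : nat} (a b : 'rV[R]_d) : R :=
  \prod_(i < d) (b ord0 i - a ord0 i).

(* Lebesgue outer measure: infimum of the total volume over all finite or
   countable covers by boxes.  The index set D makes the empty cover available,
   which is needed only for d = 0, where every box is the whole space and has
   volume 1. *)
Definition lebesgue_outer {R : realType} {d : nat}
    (A : set 'rV[R]_d) : \bar R :=
  ereal_inf [set v | exists (D : set nat) (a b : nat -> 'rV[R]_d),
    [/\ forall k i, a k ord0 i <= b k ord0 i,
        A `<=` \bigcup_(k in D) box (a k) (b k) &
        v = (\esum_(k in D) (box_volume (a k) (b k))%:E)%E]].

(* On the sets satisfying Caratheodory's criterion, [lebesgue_outer] is Lebesgue
   measure. *)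
Definition lebesgue_measurable {R : realType} {d : nat}
    (A : set 'rV[R]_d) : Prop :=
  caratheodory_measurable (@lebesgue_outer R d) A.

(* Main.v *)
Require Import Defs.
From HB Require Import structures.
From mathcomp Require Import all_boot all_order all_algebra.
From mathcomp Require Import all_classical all_reals all_analysis.
From mathcomp Require Import zify ring lra.

Set Implicit Arguments.
Unset Strict Implicit.
Unset Printing Implicit Defensive.

Import Order.TTheory GRing.Theory Num.Theory.

Local Open Scope classical_set_scope.
Local Open Scope ring_scope.

(** Cut the cube into a nested grid of cells: each cell of level [k] has [B ^ d]
    subcells of level [k + 1], where [B] is the base.  Say that a cell has a hole
    when one of its subcells contains no point of [E].

    A cell without a hole is good for its coarse pairs.  If [x] and [y] lie in it
    at a distance much larger than the side of a subcell, the segment from [x] to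
    [y] stays in the cell by convexity, and near each of its points there is a
    point of [E] in the same subcell; sampling the segment gives the chain
    ([chain_near_segment], [segment_near_set]).

    Holes are rare, uniformly in [E].  Each time a point of [E] sits in a cell with
    a hole, at least the proportion [B ^- d] of that cell is lost forever, so the
    points that meet [n] such cells are covered by boxes of total volume at most a
    constant times [(1 - B ^- d) ^+ n] ([sum_exit_word_le],
    [lebesgue_outer_exceptional_le]).  These points form [Z].  The bound is a
    statement on finite trees: cells are words over an alphabet of [B ^ d] letters.

    A remaining point meets fewer than [n] cells with a hole.  Its colour records
    which subcell it enters after each of them.  Two points of the same colour that
    share a cell with a hole then share a subcell, so they are too close for this
    cell to be the one that matters for them ([hole_colour_next]).  The number of
    colours depends on [n], [B] and [d] only.

    Two nearby points may be separated by a coarse cell wall of one grid.  This is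
    why [2 ^ d] grids are used, shifted by half a cell in some coordinates; as [B]
    is odd, the walls of two shifted grids stay half a cell apart at every level
    ([grid_cell_one_of_two]).  Moreover the distance must be small compared with
    the cell and large compared with the subcell; with [B = L ^ 2] and grids of two
    sizes of ratio [L], the cell sides are all the [3 * L / L ^+ m], and for each
    distance one of them has the required position ([scale_exists]).  The colour
    collects the data of all these grids. *)

(** * The Euclidean norm *)

Lemma eucl_norm_ge0 (R : realType) (d : nat) (v : 'rV[R]_d) : 0 <= eucl_norm v.
Proof. exact: sqrtr_ge0. Qed.

Lemma sqr_eucl_norm (R : realType) (d : nat) (v : 'rV[R]_d) :
  eucl_norm v ^+ 2 = \sum_(i < d) v ord0 i ^+ 2.
Proof. by rewrite sqr_sqrtr// sumr_ge0// => i _; exact: sqr_ge0. Qed.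

Lemma coord_le_eucl_norm (R : realType) (d : nat) (v : 'rV[R]_d) i :
  `|v ord0 i| <= eucl_norm v.
Proof.
rewrite -sqrtr_sqr ler_sqrt; last by rewrite sumr_ge0// => j _; exact: sqr_ge0.
by rewrite (bigD1 i)//= lerDl sumr_ge0// => j _; exact: sqr_ge0.
Qed.

Lemma eucl_norm0_eq0 (R : realType) (d : nat) (v : 'rV[R]_d) :
  eucl_norm v = 0 -> v = 0.
Proof.
move=> v0; apply/rowP => i; rewrite mxE.
by apply/eqP; rewrite -normr_le0 -v0 coord_le_eucl_norm.
Qed.

Lemma eucl_norm0 (R : realType) (d : nat) : eucl_norm (0 : 'rV[R]_d) = 0.
Proof. by rewrite /eucl_norm big1 ?sqrtr0// => i _; rewrite mxE expr0n. Qed.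

Lemma eucl_normZ (R : realType) (d : nat) (c : R) (v : 'rV[R]_d) :
  eucl_norm (c *: v) = `|c| * eucl_norm v.
Proof.
rewrite /eucl_norm -sqrtr_sqr -sqrtrM ?sqr_ge0// mulr_sumr.
by under eq_bigr do rewrite mxE exprMn.
Qed.

Lemma cauchy_schwarz (R : realType) (d : nat) (u v : 'rV[R]_d) :
  \sum_(i < d) u ord0 i * v ord0 i <= eucl_norm u * eucl_norm v.
Proof.
have [u0|u0] := eqVneq (eucl_norm u) 0.
  rewrite u0 mul0r (eucl_norm0_eq0 u0) big1// => i _.
  by rewrite mxE mul0r.
have [v0|v0] := eqVneq (eucl_norm v) 0.
  rewrite v0 mulr0 (eucl_norm0_eq0 v0) big1// => i _.
  by rewrite mxE mulr0.
have up : 0 < eucl_norm u by rewrite lt_def u0 eucl_norm_ge0.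
have vp : 0 < eucl_norm v by rewrite lt_def v0 eucl_norm_ge0.
set a := eucl_norm u in u0 up *; set b := eucl_norm v in v0 vp *.
have : 0 <= \sum_(i < d) (b * u ord0 i - a * v ord0 i) ^+ 2.
  by rewrite sumr_ge0// => i _; exact: sqr_ge0.
rewrite (eq_bigr (fun i => b ^+ 2 * u ord0 i ^+ 2
    - 2 * (a * b) * (u ord0 i * v ord0 i) + a ^+ 2 * v ord0 i ^+ 2)); last first.
  by move=> i _; ring.
rewrite big_split sumrB/= -!mulr_sumr -!sqr_eucl_norm -/a -/b.
have abp : 0 < a * b by rewrite mulr_gt0.
move=> h; rewrite -(ler_pM2l abp); move: h; nra.
Qed.

Lemma ler_eucl_normD (R : realType) (d : nat) (u v : 'rV[R]_d) :
  eucl_norm (u + v) <= eucl_norm u + eucl_norm v.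
Proof.
rewrite -(@ler_pXn2r _ 2)// ?nnegrE ?addr_ge0 ?eucl_norm_ge0//.
have -> : eucl_norm (u + v) ^+ 2 = eucl_norm u ^+ 2 +
    2 * (\sum_(i < d) u ord0 i * v ord0 i) + eucl_norm v ^+ 2.
  rewrite !sqr_eucl_norm mulr_sumr -!big_split/=.
  by apply: eq_bigr => i _; rewrite mxE; ring.
by have := cauchy_schwarz u v; lra.
Qed.

Lemma eucl_norm_le_sup (R : realType) (d : nat) (v : 'rV[R]_d) (c : R) :
  0 <= c -> (forall i, `|v ord0 i| <= c) -> eucl_norm v <= d%:R * c.
Proof.
move=> c0 vc.
have dc0 : 0 <= d%:R * c by rewrite mulr_ge0.
rewrite -(@ler_pXn2r _ 2)// ?nnegrE ?eucl_norm_ge0// sqr_eucl_norm.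
apply: (@le_trans _ _ (\sum_(i < d) c ^+ 2)).
  apply: ler_sum => i _; rewrite -real_normK ?num_real//.
  by rewrite ler_pXn2r ?nnegrE.
rewrite sumr_const card_ord -[leLHS]mulr_natl exprMn ler_wpM2r ?sqr_ge0//.
by rewrite -natrX ler_nat; case: (d) => // n; rewrite leq_pmulr.
Qed.

(** * Lebesgue outer measure *)

Lemma box_volume_ge0 (R : realType) (d : nat) (a b : 'rV[R]_d) :
  (forall i, a ord0 i <= b ord0 i) -> 0 <= box_volume a b.
Proof. by move=> ab; rewrite prodr_ge0// => i _; rewrite subr_ge0. Qed.

(** The covers in [lebesgue_outer] are indexed by sets of natural numbers; here an
    enumeration of [I] transports a cover indexed by pairs or by words. *)
Lemma lebesgue_outer_le_esum (R : realType) (d : nat) (I : countType)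
    (A : set 'rV[R]_d) (D : set I) (a b : I -> 'rV[R]_d) :
  (forall k i, a k ord0 i <= b k ord0 i) ->
  A `<=` \bigcup_(k in D) box (a k) (b k) ->
  (lebesgue_outer A <= \esum_(k in D) (box_volume (a k) (b k))%:E)%E.
Proof.
move=> ab AD.
pose ext (f : I -> 'rV[R]_d) (n : nat) :=
  if @unpickle I n is Some k then f k else 0.
have extE f k : ext f (pickle k) = f k by rewrite /ext pickleK.
apply: ereal_inf_lbound; exists (pickle @` D), (ext a), (ext b); split.
- by move=> n i; rewrite /ext; case: unpickle => [k|//]; exact: ab.
- move=> x /AD[k Dk xk]; exists (pickle k); first by exists k.
  by rewrite !extE.
- rewrite esum_image; last by move=> ? ? _ _; exact: (pcan_inj pickleK).
  by apply: eq_esum => k _; rewrite !extE.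
Qed.

Lemma lebesgue_outer_ge0 (R : realType) (d : nat) (A : set 'rV[R]_d) :
  (0 <= lebesgue_outer A)%E.
Proof.
apply: le_ereal_inf_tmp => _ [D [a [b [ab _ ->]]]].
by apply: esum_ge0 => k _; rewrite lee_fin box_volume_ge0.
Qed.

Lemma lebesgue_outer0 (R : realType) (d : nat) :
  lebesgue_outer (set0 : set 'rV[R]_d) = 0%E.
Proof.
apply/eqP; rewrite eq_le lebesgue_outer_ge0 andbT.
apply: ereal_inf_lbound; exists set0, (fun=> 0), (fun=> 0).
by rewrite esum_set0; split.
Qed.

Lemma le_lebesgue_outer (R : realType) (d : nat) :
  {homo @lebesgue_outer R d : A B / A `<=` B >-> (A <= B)%E}.
Proof.
move=> A B AB; apply: ereal_inf_le_tmp => _ [D [a [b [ab BD ->]]]].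
by exists D, a, b; split=> //; exact: subset_trans BD.
Qed.

Lemma lebesgue_outer_sigma_subadditive (R : realType) (d : nat) :
  sigma_subadditive (@lebesgue_outer R d).
Proof.
move=> A; have [[i ioo]|] := pselect (exists i, lebesgue_outer (A i) = +oo%E).
  rewrite (eseries_pinfty _ _ ioo) ?leey// => n _.
  by rewrite -ltNye (lt_le_trans _ (lebesgue_outer_ge0 _)).
rewrite -forallNE => Aoo; apply/lee_addgt0Pr => e e0.
rewrite (le_trans _ (epsilon_trick xpredT _ (ltW e0)))//; last first.
  by move=> n; exact: lebesgue_outer_ge0.
(* Choose a cover of each [A n] whose volume is within e / 2 ^ (n + 1) of the
   infimum. *)
pose P n (c : set nat * (nat -> 'rV[R]_d) * (nat -> 'rV[R]_d)) :=
  [/\ forall k i, c.1.2 k ord0 i <= c.2 k ord0 i,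
      A n `<=` \bigcup_(k in c.1.1) box (c.1.2 k) (c.2 k) &
      (\esum_(k in c.1.1) (box_volume (c.1.2 k) (c.2 k))%:E
        <= lebesgue_outer (A n) + (e / (2 ^ n.+1)%:R)%:E)%E].
have [G PG] : {G & forall n, P n (G n)}.
  apply: (@choice _ _ P) => n.
  have en : 0 < e / (2 ^ n.+1)%:R by rewrite divr_gt0// ltr0n expn_gt0.
  have fin : lebesgue_outer (A n) \is a fin_num.
    rewrite ge0_fin_numE ?lebesgue_outer_ge0// ltey.
    by apply/eqP; exact: Aoo.
  have [_ [D [a [b [ab AD ->]]] /ltW le]] := lb_ereal_inf_adherent en fin.
  by exists (D, a, b).
apply: (@le_trans _ _ (\esum_(p in [set: nat] `*`` (fun n => (G n).1.1))
    (box_volume ((G p.1).1.2 p.2) ((G p.1).2 p.2))%:E)%E).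
  apply: (lebesgue_outer_le_esum (a := fun p : nat * nat => (G p.1).1.2 p.2)
                                 (b := fun p : nat * nat => (G p.1).2 p.2)).
    by move=> p i; have [+ _ _] := PG p.1; exact.
  move=> x [n _ Anx]; have [_ /(_ _ Anx)[k Dk xk] _] := PG n.
  by exists (n, k).
have vol0 n k : 0 <= box_volume ((G n).1.2 k) ((G n).2 k).
  by apply: box_volume_ge0 => i; have [+ _ _] := PG n; exact.
rewrite -(esum_esum (a := fun n k => (box_volume ((G n).1.2 k) ((G n).2 k))%:E));
  last by move=> n k _ _; rewrite lee_fin.
rewrite nneseries_esumT; last first.
  by move=> n; rewrite adde_ge0 ?lebesgue_outer_ge0// lee_fin divr_ge0 ?ltW.
by apply: le_esum => n _; have [] := PG n.
Qed.

HB.instance Definition _ (R : realType) (d : nat) :=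
  isOuterMeasure.Build R 'rV[R]_d (@lebesgue_outer R d)
    (@lebesgue_outer0 R d) (@lebesgue_outer_ge0 R d)
    (@le_lebesgue_outer R d) (@lebesgue_outer_sigma_subadditive R d).

Definition set_coord (R : realType) (d : nat) (v : 'rV[R]_d) i (c : R) :=
  \row_j (if j == i then c else v ord0 j).

Lemma box_volume_split (R : realType) (d : nat) (a b : 'rV[R]_d) i (c : R) :
  box_volume a b = box_volume a (set_coord b i c) + box_volume (set_coord a i c) b.
Proof.
rewrite /box_volume [LHS](bigD1 i)//= [X in _ = X + _](bigD1 i)//=.
rewrite [X in _ = _ + X](bigD1 i)//= !mxE eqxx.
under [in X in _ = X + _]eq_bigr => j ji do rewrite mxE (negbTE ji).
under [in X in _ = _ + X]eq_bigr => j ji do rewrite mxE (negbTE ji).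
by rewrite -mulrDl; congr (_ * _); rewrite [RHS]addrC subrKA.
Qed.

(** The hyperplane [x i = c] cuts each box of a cover into two boxes whose
    volumes add up. *)
Lemma lebesgue_measurable_halfspace (R : realType) (d : nat) (i : 'I_d) (c : R) :
  lebesgue_measurable [set x : 'rV[R]_d | x ord0 i <= c].
Proof.
apply: (@le_caratheodory_measurable R _ (@lebesgue_outer R d)) => X.
apply: le_ereal_inf_tmp => _ [D [a [b [ab XD ->]]]].
pose m k := Num.min (b k ord0 i) (Num.max (a k ord0 i) c).
have am k : a k ord0 i <= m k by rewrite le_min ab le_max lexx.
have mb k : m k <= b k ord0 i by rewrite ge_min lexx.
rewrite (eq_esum (fun k _ => congr1 EFin (box_volume_split (a k) (b k) i (m k)))).
under eq_esum do rewrite EFinD.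
have ab1 k j : a k ord0 j <= set_coord (b k) i (m k) ord0 j.
  by rewrite mxE; case: eqP => [->|_].
have ab2 k j : set_coord (a k) i (m k) ord0 j <= b k ord0 j.
  by rewrite mxE; case: eqP => [->|_].
rewrite esumD; try by move=> k _; rewrite lee_fin box_volume_ge0.
apply: leeD; apply: lebesgue_outer_le_esum => // x [/XD[k Dk xk] /= xc];
  exists k => // j; rewrite mxE; have /andP[axj xbj] := xk j;
  case: eqP => [ji|_]; rewrite ?axj ?xbj// ?andbT; subst j.
- by rewrite le_min xbj le_max xc orbT.
- rewrite gt_min; apply/orP; right; rewrite gt_max axj/= ltNge; exact/negP.
Qed.

Lemma lebesgue_measurable_box (R : realType) (d : nat) (a b : 'rV[R]_d) :
  lebesgue_measurable (box a b).
Proof.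
suff box_seq (s : seq 'I_d) : lebesgue_measurable
    [set x : 'rV[R]_d | forall i, i \in s -> a ord0 i < x ord0 i <= b ord0 i].
  have -> : box a b = [set x : 'rV[R]_d | forall i, i \in enum 'I_d ->
      a ord0 i < x ord0 i <= b ord0 i].
    by apply/seteqP; split => x /= xab i; [move=> _|]; apply: xab; rewrite ?mem_enum.
  exact: box_seq.
elim: s => [|i s IHs].
  rewrite [X in lebesgue_measurable X](_ : _ = ~` set0).
    apply: (@caratheodory_measurable_setC R _ (@lebesgue_outer R d)).
    exact: (@caratheodory_measurable_set0 R _ (@lebesgue_outer R d)).
  by rewrite setC0; apply/seteqP; split.
rewrite [X in lebesgue_measurable X](_ : _ =
  (([set x : 'rV[R]_d | x ord0 i <= b ord0 i] `\`
    [set x : 'rV[R]_d | x ord0 i <= a ord0 i]) `&`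
  [set x : 'rV[R]_d | forall j, j \in s -> a ord0 j < x ord0 j <= b ord0 j])).
  apply: (@caratheodory_measurable_setI R _ (@lebesgue_outer R d)) => //.
  apply: (@caratheodory_measurable_setD R _ (@lebesgue_outer R d));
    exact: lebesgue_measurable_halfspace.
apply/seteqP; split => x /=.
  move=> xis; split; last by move=> j js; apply: xis; rewrite inE js orbT.
  have /andP[ax xb] := xis i (mem_head _ _).
  by split => //; apply/negP; rewrite -ltNge.
move=> [[xb /negP ax] xs] j; rewrite inE => /orP[/eqP ->|]; last exact: xs.
by rewrite xb ltNge ax.
Qed.

Lemma lebesgue_measurable_bigcup (R : realType) (d : nat) (I : countType)
    (D : set I) (A : I -> set 'rV[R]_d) :
  (forall k, lebesgue_measurable (A k)) ->
  lebesgue_measurable (\bigcup_(k in D) A k).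
Proof.
move=> mA; have m0 := @caratheodory_measurable_set0 R _ (@lebesgue_outer R d).
pose B n := if @unpickle I n is Some k then
  (if k \in D then A k else set0) else set0.
rewrite [X in lebesgue_measurable X](_ : _ = \bigcup_n B n).
  apply: (@caratheodory_measurable_bigcup R _ (@lebesgue_outer R d)) => n.
  rewrite /B; case: unpickle => [k|]; last exact: m0.
  by case: ifP => _; [exact: mA|exact: m0].
apply/seteqP; split => [x [k Dk xk]|x [n _]].
  by exists (pickle k) => //; rewrite /B pickleK mem_set.
rewrite /B; case: unpickle => [k|//]; case: ifPn => // /set_mem Dk xk.
by exists k.
Qed.

(** * Holes in a tree of words *)

(** A word stands for a cell of the grid, its letters for the successive choices of
    a subcell, and [alive] for the cells that meet the given set. *)
Definition has_hole (A : finType) (alive : pred (seq A)) (w : seq A) : bool :=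
  [exists a, ~~ alive (rcons w a)].

(** The word [w ++ u] is where a walk from [w] through alive words arrives on leaving
    its [n]-th word with a hole.  For fixed [n] these words are pairwise not prefixes
    of one another: they are disjoint cells that cover what survives [n] holes. *)
Fixpoint exit_word (A : finType) (alive : pred (seq A)) (n : nat) (w u : seq A)
    : bool :=
  match n, u with
  | 0, [::] => true
  | n'.+1, a :: u' => alive (rcons w a) &&
      if has_hole alive w then exit_word alive n' (rcons w a) u'
      else exit_word alive n (rcons w a) u'
  | _, _ => false
  end%N.

(** Each hole deletes at least one of the [#|A|] children of a word, hence a
    proportion [#|A|^-1] of its weight, whatever the depths of the holes.  The sum
    runs over an arbitrary finite set of words, so that the bound passes to
    infinite sums; induction on the length of the longest word. *)
Lemma sum_exit_word_le (R : realFieldType) (A : finType) (alive : pred (seq A))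
    (a0 : A) (n : nat) (w : seq A) (X : seq (seq A)) :
  uniq X -> {in X, forall u, exit_word alive n w u} ->
  \sum_(u <- X) #|A|%:R^-1 ^+ size u <= (1 - #|A|%:R^-1) ^+ n :> R.
Proof.
pose b : R := #|A|%:R^-1; rewrite -/b.
have A0 : (0 < #|A|)%N by apply/card_gt0P; exists a0.
have cardb : #|A|%:R * b = 1 by rewrite mulfV// pnatr_eq0 -lt0n.
have b0 : 0 <= b by rewrite invr_ge0.
have b1 : 0 <= 1 - b by rewrite subr_ge0 invf_le1 ?ltr0n// ler1n.
move=> uX Xexit.
have base v Y : uniq Y -> {in Y, forall u, exit_word alive 0 v u} ->
    \sum_(u <- Y) b ^+ size u <= 1.
  move=> uY Yexit.
  have Ynil u : u \in Y -> u = [::] by move=> /Yexit; case: u.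
  case: Y uY Ynil {Yexit} => [|u [|u' Y]] uY Ynil; first by rewrite big_nil.
    by rewrite big_seq1 (Ynil u) ?mem_head.
  by move: uY; rewrite (Ynil u) ?mem_head// (Ynil u') ?inE ?eqxx ?orbT.
have [K XK] : exists K, {in X, forall u, (size u <= K)%N}.
  exists (\max_(u <- X) size u) => u uX'.
  by rewrite (big_rem u)//= leq_maxl.
elim: K n w X uX Xexit XK => [|K IHK] [|n] w X uX Xexit XK;
  [exact: base Xexit| |exact: base Xexit|]; last first.
- pose tails a := [seq behead u | u <- X & head a0 u == a].
  have nonempty u : u \in X -> exists a v, u = a :: v.
    by move=> /Xexit; case: u => // a v; exists a, v.
  have mem_tails a v : v \in tails a -> (a :: v) \in X.
    move=> /mapP[u]; rewrite mem_filter => /andP[/eqP ua uX'] ->.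
    by have [c [t ut]] := nonempty _ uX'; move: ua uX'; rewrite ut /= => ->.
  have tails_uniq a : uniq (tails a).
    rewrite map_inj_in_uniq ?filter_uniq// => u v.
    rewrite !mem_filter => /andP[/eqP ua uX'] /andP[/eqP va vX'].
    have [c [t ut]] := nonempty _ uX'; have [c' [t' vt]] := nonempty _ vX'.
    by move: ua va; rewrite ut vt /= => -> -> ->.
  have tails_size a : {in tails a, forall v, (size v <= K)%N}.
    by move=> v /mem_tails/XK.
  have -> : \sum_(u <- X) b ^+ size u = \sum_a b * \sum_(v <- tails a) b ^+ size v.
    rewrite (partition_big (head a0) xpredT)//=; apply: eq_bigr => a _.
    rewrite big_map big_filter mulr_sumr big_seq_cond [RHS]big_seq_cond.
    apply: eq_bigr => u /andP[uX' _].
    by have [c [t ->]] := nonempty _ uX'; rewrite exprS.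
  have [hole|nohole] := boolP (has_hole alive w); last first.
    apply: (@le_trans _ _ (\sum_(a : A) b * (1 - b) ^+ n.+1)); last first.
      by rewrite sumr_const -mulr_natl mulrA cardb mul1r.
    apply: ler_sum => a _; apply: ler_wpM2l => //.
    apply: (IHK _ (rcons w a)) => // v /mem_tails/Xexit /=.
    by rewrite (negbTE nohole) => /andP[].
  have /existsP[c dead] := hole.
  rewrite (bigD1 c)//= [X in _ * X]big_seq big1 ?mulr0 ?add0r; last first.
    by move=> v /mem_tails/Xexit /=; rewrite (negbTE dead).
  apply: (@le_trans _ _ (\sum_(a | a != c) b * (1 - b) ^+ n)); last first.
    rewrite sumr_const cardC1 -mulr_natl mulrA exprS ler_wpM2r ?exprn_ge0//.
    by rewrite -subn1 natrB// mulrBl mul1r cardb.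
  apply: ler_sum => a _; apply: ler_wpM2l => //.
  apply: (IHK _ (rcons w a)) => // v /mem_tails/Xexit /=.
  by rewrite hole => /andP[].
- case: X Xexit XK {uX} => [|u X] Xexit XK; first by rewrite big_nil exprn_ge0.
  have := Xexit u (mem_head _ _); have := XK u (mem_head _ _).
  by case: u {Xexit XK}.
Qed.

Definition hole_count (A : finType) (alive : pred (seq A)) (s : nat -> A)
    (k : nat) : nat :=
  count (fun j => has_hole alive (mkseq s j)) (iota 0 k).

Lemma hole_countS (A : finType) (alive : pred (seq A)) (s : nat -> A) k :
  hole_count alive s k.+1 = (hole_count alive s k + has_hole alive (mkseq s k))%N.
Proof. by rewrite /hole_count -addn1 iotaD count_cat/= addn0. Qed.

Lemma leq_hole_count (A : finType) (alive : pred (seq A)) (s : nat -> A) :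
  {homo hole_count alive s : j k / (j <= k)%N >-> (j <= k)%N}.
Proof.
move=> j k jk; rewrite -(subnKC jk); elim: (k - j)%N => [|m IHm].
  by rewrite addn0.
by rewrite addnS hole_countS (leq_trans IHm)// leq_addr.
Qed.

Lemma mkseqS_rcons (T : Type) (s : nat -> T) k :
  mkseq s k.+1 = rcons (mkseq s k) (s k).
Proof. by rewrite /mkseq -addn1 iotaD map_cat cats1. Qed.

(** A sequence that meets [n] holes passes through a word that ends just after the
    [n]-th one, which is how the sequence gets covered. *)
Lemma exit_word_exists (A : finType) (alive : pred (seq A)) (s : nat -> A)
    (n k : nat) :
  (forall j, alive (mkseq s j)) -> (n <= hole_count alive s k)%N ->
  exists l, exit_word alive n [::] (mkseq s l).
Proof.
move=> s_alive.
suff gen m j n' :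
    (n' <= count (fun i => has_hole alive (mkseq s i)) (iota j m))%N ->
    exists l, exit_word alive n' (mkseq s j) (map s (iota j l)) by exact: gen.
elim: m j n' => [|m IHm] j [|n']//=; try by move=> _; exists 0%N.
have [hole|nohole] := boolP (has_hole alive (mkseq s j)) => /=.
  move=> /(IHm j.+1)[l exit]; exists l.+1 => /=.
  by rewrite hole -mkseqS_rcons s_alive.
move=> /(IHm j.+1)[l exit]; exists l.+1 => /=.
by rewrite (negbTE nohole) -mkseqS_rcons s_alive.
Qed.

(** The colour of a sequence lists the letters that follow its first [n] prefixes
    with a hole.  Sequences with a common prefix number their holes alike up to
    that prefix, so equal colours force equal next letters after a hole. *)
Definition hole_colour (A : finType) (alive : pred (seq A)) (n : nat)
    (s : nat -> A) : {ffun 'I_n -> A} :=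
  [ffun i : 'I_n => s (xget 0%N [set k | has_hole alive (mkseq s k) /\
                                         hole_count alive s k = i])].

Lemma hole_colourE (A : finType) (alive : pred (seq A)) (n : nat)
    (s : nat -> A) (k : nat) (lt_n : (hole_count alive s k < n)%N) :
  has_hole alive (mkseq s k) -> hole_colour alive n s (Ordinal lt_n) = s k.
Proof.
move=> hole; rewrite ffunE; congr s.
apply: xget_unique => //= j [hole_j eq_j].
have [jk|kj|//] := ltngtP j k.
- have := leq_hole_count alive s jk; rewrite hole_countS hole_j eq_j.
  by rewrite addn1 ltnn.
- have := leq_hole_count alive s kj; rewrite hole_countS hole eq_j.
  by rewrite addn1 ltnn.
Qed.

Lemma hole_colour_next (A : finType) (alive : pred (seq A)) (n : nat)
    (s t : nat -> A) (k : nat) :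
  hole_colour alive n s = hole_colour alive n t ->
  mkseq s k = mkseq t k -> has_hole alive (mkseq s k) ->
  (hole_count alive s k < n)%N -> s k = t k.
Proof.
move=> col pre hole lt_n.
have eq_count : hole_count alive t k = hole_count alive s k.
  apply: eq_in_count => j; rewrite mem_iota add0n => /andP[_ jk]; congr has_hole.
  apply: (@eq_from_nth _ (s j)); rewrite ?size_mkseq// => i ij.
  have ik := ltn_trans ij jk.
  by rewrite !nth_mkseq// -(nth_mkseq (s j) s ik) pre nth_mkseq.
have lt_n' : (hole_count alive t k < n)%N by rewrite eq_count.
rewrite -(hole_colourE lt_n hole) col -(hole_colourE lt_n') -?pre//.
by congr (hole_colour _ _ _ _); apply: val_inj; rewrite /= eq_count.
Qed.

(** * Nested grids of boxes *)

(** The coordinate is reversed so that the cells, half-open on the left in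
    [grid_coord], are half-open on the right as boxes.  The bit [h] selects one of
    two grids shifted by half a cell with respect to each other. *)
Definition grid_coord (R : realType) (S : R) (h : bool) (t : R) : R :=
  (1 - t) / S + h%:R / 2.

Definition grid_cell (R : realType) (b : nat) (S : R) (h : bool) (k : nat) (t : R)
    : nat :=
  Num.truncn (b.+1%:R ^+ k * grid_coord S h t).

Definition grid_digits (R : realType) (d b : nat) (S : R) (h : {ffun 'I_d -> bool})
    (x : 'rV[R]_d) (k : nat) : {ffun 'I_d -> 'I_b.+1} :=
  [ffun i => inord (grid_cell b S (h i) k.+1 (x ord0 i) %% b.+1)].

Lemma grid_coord_itv (R : realType) (S : R) (h : bool) (t : R) :
  3 <= S -> 0 <= t <= 1 -> 0 <= grid_coord S h t < 1.
Proof.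
move=> S3 /andP[t0 t1]; have S0 : 0 < S by lra.
have c0 : 0 <= (1 - t) / S by rewrite divr_ge0//; lra.
have c1 : (1 - t) / S <= 1 / 3 by rewrite ler_pdivrMr//; nra.
by rewrite /grid_coord; case: h => /=; apply/andP; split; lra.
Qed.

Lemma grid_cell_itv (R : realType) (b : nat) (S : R) (h : bool) (k : nat) (t : R) :
  3 <= S -> 0 <= t <= 1 ->
  (grid_cell b S h k t)%:R <= b.+1%:R ^+ k * grid_coord S h t
    < (grid_cell b S h k t).+1%:R.
Proof.
move=> S3 /(grid_coord_itv h S3)/andP[c0 _].
by apply: truncn_itv; rewrite mulr_ge0// exprn_ge0.
Qed.

Lemma grid_cellP (R : realType) (b : nat) (S : R) (h : bool) (k : nat) (t : R) n :
  n%:R <= b.+1%:R ^+ k * grid_coord S h t < n.+1%:R -> grid_cell b S h k t = n.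
Proof. exact: truncn_def. Qed.

Lemma grid_cell0 (R : realType) (b : nat) (S : R) (h : bool) (t : R) :
  3 <= S -> 0 <= t <= 1 -> grid_cell b S h 0 t = 0%N.
Proof.
by move=> S3 /(grid_coord_itv h S3) c01; apply: grid_cellP; rewrite expr0 mul1r.
Qed.

Lemma grid_cell_parent (R : realType) (b : nat) (S : R) (h : bool) (k : nat) (t : R) :
  3 <= S -> 0 <= t <= 1 ->
  (grid_cell b S h k.+1 t %/ b.+1)%N = grid_cell b S h k t.
Proof.
move=> S3 t01; apply/esym/grid_cellP.
have := grid_cell_itv b h k.+1 S3 t01; rewrite exprS -mulrA.
set N := grid_cell _ _ _ _ _; set u := _ ^+ k * _ => /andP[lo hi].
have b0 : 0 < b.+1%:R :> R by rewrite ltr0n.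
apply/andP; split; rewrite -(ler_pM2l b0, ltr_pM2l b0) -natrM.
  by apply: le_trans lo; rewrite ler_nat mulnC leq_divM.
by apply: lt_le_trans hi _; rewrite ler_nat mulnC ltn_ceil.
Qed.

Lemma val_grid_digits (R : realType) (d b : nat) (S : R) (h : {ffun 'I_d -> bool})
    (x : 'rV[R]_d) k i :
  grid_digits b S h x k i = (grid_cell b S (h i) k.+1 (x ord0 i) %% b.+1)%N :> nat.
Proof. by rewrite ffunE inordK// ltn_mod. Qed.

(** The number whose base [b.+1] digits are the [i]-th coordinates of the letters
    of [w], most significant first. *)
Definition word_value (d b : nat) (i : 'I_d) (w : seq {ffun 'I_d -> 'I_b.+1}) : nat :=
  foldl (fun v (a : {ffun 'I_d -> 'I_b.+1}) => v * b.+1 + a i)%N 0%N w.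

Lemma word_value_digits (R : realType) (d b : nat) (S : R)
    (h : {ffun 'I_d -> bool}) (x : 'rV[R]_d) k i :
  3 <= S -> unit_cube x ->
  word_value i (mkseq (grid_digits b S h x) k) = grid_cell b S (h i) k (x ord0 i).
Proof.
move=> S3 x01; elim: k => [|k IHk]; first by rewrite grid_cell0.
rewrite mkseqS_rcons /word_value foldl_rcons -/(word_value _ _) IHk.
by rewrite val_grid_digits -(grid_cell_parent b (h i) k S3 (x01 i)) -divn_eq.
Qed.

Lemma same_cell_same_word (R : realType) (d b : nat) (S : R)
    (h : {ffun 'I_d -> bool}) (x y : 'rV[R]_d) k :
  3 <= S -> unit_cube x -> unit_cube y ->
  (forall i, grid_cell b S (h i) k (x ord0 i) = grid_cell b S (h i) k (y ord0 i)) ->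
  mkseq (grid_digits b S h x) k = mkseq (grid_digits b S h y) k.
Proof.
move=> S3 x01 y01; elim: k => [//|k IHk] same.
rewrite !mkseqS_rcons IHk.
  by congr rcons; apply/ffunP => i; rewrite !ffunE same.
by move=> i; rewrite -!(@grid_cell_parent _ _ _ _ k)// same.
Qed.

Lemma grid_cell_dist (R : realType) (b : nat) (S : R) (h : bool) (k : nat) (s t : R) :
  3 <= S -> 0 <= s <= 1 -> 0 <= t <= 1 ->
  grid_cell b S h k s = grid_cell b S h k t -> `|s - t| < S / b.+1%:R ^+ k.
Proof.
move=> S3 s01 t01 st; have S0 : 0 < S by lra.
have B0 : 0 < b.+1%:R ^+ k :> R by rewrite exprn_gt0// ltr0n.
have := grid_cell_itv b h k S3 s01; have := grid_cell_itv b h k S3 t01.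
rewrite -st; set N := grid_cell _ _ _ _ _; rewrite -[N.+1%:R]natr1 /grid_coord.
set B := b.+1%:R ^+ k in B0 *; set c := h%:R / 2 => /andP[lo hi] /andP[lo' hi'].
have -> : s - t = (B * ((1 - t) / S + c) - B * ((1 - s) / S + c)) * (S / B).
  by field; rewrite !gt_eqF.
rewrite normrM [X in _ * X]gtr0_norm ?divr_gt0// gtr_pMl ?divr_gt0//.
by rewrite ltr_norml; lra.
Qed.

Lemma grid_cell_between (R : realType) (b : nat) (S : R) (h : bool) (k : nat)
    (s t th : R) :
  3 <= S -> 0 <= s <= 1 -> 0 <= t <= 1 -> 0 <= th <= 1 ->
  grid_cell b S h k s = grid_cell b S h k t ->
  grid_cell b S h k (s + th * (t - s)) = grid_cell b S h k s.
Proof.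
move=> S3 s01 t01 /andP[th0 th1] st.
have := grid_cell_itv b h k S3 s01; have := grid_cell_itv b h k S3 t01.
rewrite -st; set N := grid_cell _ _ _ k s => lohi' lohi; apply: grid_cellP.
have S0 : S != 0 by rewrite gt_eqF//; lra.
have -> : b.+1%:R ^+ k * grid_coord S h (s + th * (t - s)) =
  (1 - th) * (b.+1%:R ^+ k * grid_coord S h s) +
  th * (b.+1%:R ^+ k * grid_coord S h t).
  by rewrite /grid_coord; field.
move: lohi lohi'; set u := _ * grid_coord _ _ s; set v := _ * grid_coord _ _ t.
move=> /andP[Nu uN] /andP[Nv vN].
have mean : Num.min u v <= (1 - th) * u + th * v <= Num.max u v.
  by case: (leP u v) => uv; apply/andP; split; nra.
have /andP[ge_min le_max] := mean.
apply/andP; split; first by apply: le_trans ge_min; rewrite le_min Nu Nv.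
by apply: le_lt_trans le_max _; rewrite gt_max uN vN.
Qed.

(** Since an odd power divided by 2 is a half-integer, at every level the
    boundaries of the two grids are half a cell apart; hence two points at distance
    less than half a cell are not separated by both. *)
Lemma grid_cell_one_of_two (R : realType) (b : nat) (S : R) (k : nat) (s t : R) :
  odd b.+1 -> 3 <= S -> 0 <= s <= 1 -> 0 <= t <= 1 ->
  `|s - t| < S / b.+1%:R ^+ k / 2 ->
  exists h, grid_cell b S h k s = grid_cell b S h k t.
Proof.
move=> oddb S3; wlog ts : s t / t <= s.
  move=> th s01 t01; have [ts|/ltW st] := leP t s; first exact: th.
  by rewrite distrC => /(th _ _ st t01 s01)[h eq_cell]; exists h.
move=> s01 t01; rewrite ger0_norm ?subr_ge0// => st.
have S0 : 0 < S by lra.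
have B0 : 0 < b.+1%:R ^+ k :> R by rewrite exprn_gt0// ltr0n.
have [eq0|neq0] := eqVneq (grid_cell b S false k s) (grid_cell b S false k t).
  by exists false.
exists true.
(* The number [B ^ k / 2] by which the shift acts at level [k] is a half-integer. *)
have half : b.+1%:R ^+ k = (b.+1 ^ k)./2%:R * 2 + 1 :> R.
  rewrite -natrX -[X in X%:R = _]odd_double_half oddX oddb orbT.
  by rewrite natrD -muln2 natrM addrC.
have shift u : b.+1%:R ^+ k * grid_coord S true u =
    b.+1%:R ^+ k * grid_coord S false u + (b.+1 ^ k)./2%:R + 1 / 2.
  by rewrite /grid_coord /= mul0r addr0 mulrDr -addrA; congr +%R; rewrite half; field.
have close : b.+1%:R ^+ k * grid_coord S false t
    < b.+1%:R ^+ k * grid_coord S false s + 1 / 2.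
  have -> : b.+1%:R ^+ k * grid_coord S false t =
      b.+1%:R ^+ k * grid_coord S false s + b.+1%:R ^+ k / S * (s - t).
    by rewrite /grid_coord; field; rewrite gt_eqF.
  rewrite ltrD2l -ltr_pdivlMl ?divr_gt0// invf_div; move: st.
  by rewrite div1r.
have mono : b.+1%:R ^+ k * grid_coord S false s <=
    b.+1%:R ^+ k * grid_coord S false t.
  by rewrite ler_pM2l// lerD2r ler_pM2r ?invr_gt0// lerD2l lerN2.
have lt_cell : (grid_cell b S false k s < grid_cell b S false k t)%N.
  by rewrite ltn_neqAle neq0 le_truncn.
have /andP[_ his] := grid_cell_itv b false k S3 s01.
have /andP[lot _] := grid_cell_itv b false k S3 t01.
(* The wall [m] separates the points in the unshifted grid; both lie within 1/2
   of it. *)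
set m := grid_cell b S false k t in lt_cell lot.
have {his} : b.+1%:R ^+ k * grid_coord S false s < m%:R.
  by apply: (lt_le_trans his); rewrite ler_nat.
move: shift close mono lot.
set N := _./2; set u := _ * grid_coord S false s; set v := _ * grid_coord S false t.
move=> shift close mono lot his.
have cell_true z : m%:R - 1 / 2 <= b.+1%:R ^+ k * grid_coord S false z < m%:R + 1 / 2 ->
    grid_cell b S true k z = (m + N)%N.
  move=> /andP[? ?]; apply: grid_cellP; rewrite shift -[(m + N).+1%:R]natr1 natrD.
  by apply/andP; split; lra.
by rewrite !cell_true// -/u -/v; apply/andP; split; lra.
Qed.

(** The corners of the cell of a word: [mem_word_box] holds because [t] lies between
    these bounds when [b.+1 ^ size w * grid_coord S (h i) t] has integer part
    [word_value i w]. *)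
Definition word_lo (R : realType) (d b : nat) (S : R) (h : {ffun 'I_d -> bool})
    (w : seq {ffun 'I_d -> 'I_b.+1}) : 'rV[R]_d :=
  \row_i (1 - S * ((word_value i w).+1%:R / b.+1%:R ^+ size w - (h i)%:R / 2)).

Definition word_hi (R : realType) (d b : nat) (S : R) (h : {ffun 'I_d -> bool})
    (w : seq {ffun 'I_d -> 'I_b.+1}) : 'rV[R]_d :=
  \row_i (1 - S * ((word_value i w)%:R / b.+1%:R ^+ size w - (h i)%:R / 2)).

Lemma word_hi_sub_lo (R : realType) (d b : nat) (S : R) (h : {ffun 'I_d -> bool})
    (w : seq {ffun 'I_d -> 'I_b.+1}) i :
  word_hi S h w ord0 i - word_lo S h w ord0 i = S / b.+1%:R ^+ size w.
Proof. by rewrite !mxE -[(word_value i w).+1%:R]natr1; ring. Qed.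

Lemma word_lo_le_hi (R : realType) (d b : nat) (S : R) (h : {ffun 'I_d -> bool})
    (w : seq {ffun 'I_d -> 'I_b.+1}) i :
  0 <= S -> word_lo S h w ord0 i <= word_hi S h w ord0 i.
Proof. by move=> S0; rewrite -subr_ge0 word_hi_sub_lo divr_ge0// exprn_ge0. Qed.

Lemma word_box_volume (R : realType) (d b : nat) (S : R) (h : {ffun 'I_d -> bool})
    (w : seq {ffun 'I_d -> 'I_b.+1}) :
  box_volume (word_lo S h w) (word_hi S h w) =
  S ^+ d * #|{ffun 'I_d -> 'I_b.+1}|%:R^-1 ^+ size w.
Proof.
rewrite /box_volume; under eq_bigr do rewrite word_hi_sub_lo.
rewrite prodr_const card_ord exprMn card_ffun !card_ord natrX.
by rewrite !exprVn -!exprM mulnC.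
Qed.

Lemma mem_word_box (R : realType) (d b : nat) (S : R) (h : {ffun 'I_d -> bool})
    (x : 'rV[R]_d) k :
  3 <= S -> unit_cube x ->
  box (word_lo S h (mkseq (grid_digits b S h x) k))
      (word_hi S h (mkseq (grid_digits b S h x) k)) x.
Proof.
move=> S3 x01 i; rewrite !mxE size_mkseq word_value_digits//.
have := grid_cell_itv b (h i) k S3 (x01 i).
set N := grid_cell _ _ _ _ _; set t := x ord0 i; set B := b.+1%:R ^+ k.
rewrite /grid_coord; set c := _%:R / 2.
have S0 : 0 < S by lra.
have B0 : 0 < B by rewrite exprn_gt0// ltr0n.
rewrite -ler_pdivrMl// -ltr_pdivlMl// ![B^-1 * _]mulrC => /andP[lo hi].
apply/andP; split.
  rewrite ltrBlDl -ltrBlDr -ltr_pdivrMl// mulrC; lra.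
rewrite lerBrDl -lerBrDr -ler_pdivlMl// [S^-1 * _]mulrC; lra.
Qed.

Definition alive_word (R : realType) (d b : nat) (S : R) (h : {ffun 'I_d -> bool})
    (E : set 'rV[R]_d) : pred (seq {ffun 'I_d -> 'I_b.+1}) :=
  fun w => `[< exists2 e, E e & mkseq (grid_digits b S h e) (size w) = w >].

Lemma alive_mkseq (R : realType) (d b : nat) (S : R) (h : {ffun 'I_d -> bool})
    (E : set 'rV[R]_d) x k :
  E x -> alive_word S h E (mkseq (grid_digits b S h x) k).
Proof. by move=> Ex; apply/asboolP; exists x => //; rewrite size_mkseq. Qed.

(** A countable union of boxes, so that its intersection with a measurable [E] is
    measurable. *)
Definition exceptional (R : realType) (d b : nat) (S : R) (h : {ffun 'I_d -> bool})
    (E : set 'rV[R]_d) (n : nat) : set 'rV[R]_d :=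
  \bigcup_(w in [set w : seq {ffun 'I_d -> 'I_b.+1} |
                 exit_word (alive_word S h E) n [::] w])
    box (word_lo S h w) (word_hi S h w).

Lemma lebesgue_measurable_exceptional (R : realType) (d b : nat) (S : R)
    (h : {ffun 'I_d -> bool}) (E : set 'rV[R]_d) n :
  lebesgue_measurable (exceptional b S h E n).
Proof.
by apply: lebesgue_measurable_bigcup => w; exact: lebesgue_measurable_box.
Qed.

Lemma lebesgue_outer_exceptional_le (R : realType) (d b : nat) (S : R)
    (h : {ffun 'I_d -> bool}) (E : set 'rV[R]_d) n :
  0 <= S ->
  (lebesgue_outer (exceptional b S h E n) <=
    (S ^+ d * (1 - #|{ffun 'I_d -> 'I_b.+1}|%:R^-1) ^+ n)%:E)%E.
Proof.
move=> S0; apply: (le_trans (lebesgue_outer_le_esum _ (@subset_refl _ _))).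
  by move=> w i; exact: word_lo_le_hi.
apply: ge_ereal_sup => _ [X [finX Xexit] <-].
rewrite fsbig_finite//= sumEFin lee_fin.
under eq_bigr do rewrite word_box_volume.
rewrite -mulr_sumr ler_wpM2l ?exprn_ge0//.
apply: (@sum_exit_word_le _ _ (alive_word S h E) [ffun=> ord0] n [::]).
  exact: finmap.fset_uniq.
by move=> w; rewrite in_fset_set// inE => /Xexit.
Qed.

Lemma hole_count_lt (R : realType) (d b : nat) (S : R) (h : {ffun 'I_d -> bool})
    (E : set 'rV[R]_d) n x k :
  3 <= S -> E `<=` unit_cube -> E x -> ~ exceptional b S h E n x ->
  (hole_count (alive_word S h E) (grid_digits b S h x) k < n)%N.
Proof.
move=> S3 E01 Ex not_exc; rewrite ltnNge; apply/negP => le_n; apply: not_exc.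
have [l exit] := exit_word_exists (fun j => alive_mkseq b S h j Ex) le_n.
by exists (mkseq (grid_digits b S h x) l) => //; apply: mem_word_box => //; exact: E01.
Qed.

(** * Chains along a segment *)

Lemma eucl_norm_distC (R : realType) (d : nat) (u v : 'rV[R]_d) :
  eucl_norm (u - v) = eucl_norm (v - u).
Proof. by rewrite -opprB -scaleN1r eucl_normZ normrN1 mul1r. Qed.

(** Sample the segment at the multiples of [1 / N] and replace each sample by a
    nearby point of [E], keeping the end points: each step grows by at most
    [2 * sigma]. *)
Lemma chain_near_segment (R : realType) (d : nat) (E : set 'rV[R]_d)
    (x y : 'rV[R]_d) (N : nat) (sigma eta len : R) :
  E x -> E y -> (0 < N)%N -> 0 <= sigma ->
  (forall th, 0 <= th <= 1 ->
    exists2 e, E e & eucl_norm (e - (x + th *: (y - x))) <= sigma) ->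
  eucl_norm (x - y) / N%:R + 2 * sigma < eta ->
  eucl_norm (x - y) + N%:R * (2 * sigma) <= len ->
  exists s, chain_from_to_in eta x y E s /\ chain_length x s <= len.
Proof.
move=> Ex Ey N0 sigma0 near_seg step_lt len_le.
have Np : 0 < N%:R :> R by rewrite ltr0n.
pose z (j : nat) := x + (j%:R / N%:R) *: (y - x).
have z0 : z 0%N = x by rewrite /z mul0r scale0r addr0.
have zN : z N = y by rewrite /z divff ?gt_eqF// scale1r addrC subrK.
have near_z j : (j <= N)%N -> exists e, E e /\ eucl_norm (e - z j) <= sigma.
  move=> jN; have [|e Ee e_z] := near_seg (j%:R / N%:R); last by exists e.
  by rewrite divr_ge0//= ler_pdivrMr// mul1r ler_nat.
have [f0 f0P] : {f0 : nat -> 'rV[R]_d & forall j, (j <= N)%N ->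
    E (f0 j) /\ eucl_norm (f0 j - z j) <= sigma}.
  apply: (@choice _ _ (fun j e => (j <= N)%N -> E e /\ eucl_norm (e - z j) <= sigma)).
  move=> j; have [jN|jN] := leqP j N; last by exists 0.
  by have [e ?] := near_z j jN; exists e.
pose f j := if j == 0%N then x else if j == N then y else f0 j.
have fE j : (j <= N)%N -> E (f j).
  by move=> jN; rewrite /f; case: eqP => // _; case: eqP => // _; case: (f0P j jN).
have f_z j : (j <= N)%N -> eucl_norm (f j - z j) <= sigma.
  move=> jN; rewrite /f; case: eqP => [->|_]; first by rewrite z0 subrr eucl_norm0.
  by case: eqP => [->|_]; [rewrite zN subrr eucl_norm0|case: (f0P j jN)].
have step j : (j < N)%N ->
    eucl_norm (f j - f j.+1) <= eucl_norm (x - y) / N%:R + 2 * sigma.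
  move=> jN; have -> : f j - f j.+1 =
      (f j - z j) + ((z j - z j.+1) + (z j.+1 - f j.+1)).
    by rewrite addrA subrKA addrA subrK.
  have zz : eucl_norm (z j - z j.+1) = eucl_norm (x - y) / N%:R.
    have -> : z j - z j.+1 = N%:R^-1 *: (x - y).
      apply/rowP => i; rewrite !mxE -[j.+1%:R]natr1.
      by field; rewrite gt_eqF.
    by rewrite eucl_normZ gtr0_norm ?invr_gt0// mulrC.
  have := ler_eucl_normD (f j - z j) ((z j - z j.+1) + (z j.+1 - f j.+1)).
  have := ler_eucl_normD (z j - z j.+1) (z j.+1 - f j.+1).
  rewrite zz [X in _ <= _ + X -> _]eucl_norm_distC.
  by have := f_z j (ltnW jN); have := f_z j.+1 jN; lra.
pose s := mkseq (fun j => f j.+1) N.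
have f0x : f 0%N = x by [].
have nth_xs j : (j <= N)%N -> nth 0 (x :: s) j = f j.
  by case: j => [//|j] jN /=; rewrite nth_mkseq.
exists s; split; last first.
  rewrite /chain_length size_mkseq; apply: le_trans len_le.
  apply: (@le_trans _ _ (\sum_(i < N) (eucl_norm (x - y) / N%:R + 2 * sigma))).
    apply: ler_sum => i _; rewrite !nth_xs//; [exact: step|exact: ltnW].
  rewrite sumr_const card_ord -[leLHS]mulr_natl mulrDr lerD2r.
  by rewrite mulrCA divff ?gt_eqF// mulr1.
split.
- apply/(pathP 0) => j; rewrite size_mkseq => jN.
  have := nth_xs j.+1 jN => /= ->; rewrite nth_xs ?(ltnW jN)//.
  exact: le_lt_trans (step j jN) step_lt.
- rewrite (last_nth 0) size_mkseq nth_xs// /f eqxx.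
  by rewrite gtn_eqF.
- move=> v /(nthP 0)[j]; rewrite /= size_mkseq ltnS => jN <-.
  by rewrite nth_xs//; exact: fE.
Qed.

(** * Choice of the scale and of the grid *)

Lemma same_word_dist (R : realType) (d b : nat) (S : R)
    (h : {ffun 'I_d -> bool}) (x y : 'rV[R]_d) k :
  3 <= S -> unit_cube x -> unit_cube y ->
  mkseq (grid_digits b S h x) k = mkseq (grid_digits b S h y) k ->
  eucl_norm (x - y) <= d%:R * (S / b.+1%:R ^+ k).
Proof.
move=> S3 x01 y01 same; apply: eucl_norm_le_sup => [|i].
  by rewrite divr_ge0// ?exprn_ge0//; lra.
rewrite !mxE ltW// (@grid_cell_dist _ _ _ (h i))//.
by rewrite -!word_value_digits// same.
Qed.

(** By convexity a point [z] of the segment lies in the common cell of [x] and [y];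
    its subcell is not a hole, so it contains a point of [E]. *)
Lemma segment_near_set (R : realType) (d b : nat) (S : R)
    (h : {ffun 'I_d -> bool}) (E : set 'rV[R]_d) (x y : 'rV[R]_d) k (th : R) :
  3 <= S -> E `<=` unit_cube -> E x -> E y -> 0 <= th <= 1 ->
  mkseq (grid_digits b S h x) k = mkseq (grid_digits b S h y) k ->
  ~~ has_hole (alive_word S h E) (mkseq (grid_digits b S h x) k) ->
  exists2 e, E e &
    eucl_norm (e - (x + th *: (y - x))) <= d%:R * (S / b.+1%:R ^+ k.+1).
Proof.
move=> S3 E01 Ex Ey th01 same nohole; have x01 := E01 x Ex; have y01 := E01 y Ey.
set z := x + th *: (y - x).
have zE i : z ord0 i = x ord0 i + th * (y ord0 i - x ord0 i) by rewrite !mxE.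
have z01 : unit_cube z.
  move=> i; rewrite zE; have /andP[? ?] := x01 i; have /andP[? ?] := y01 i.
  by move: th01 => /andP[? ?]; apply/andP; split; nra.
have zx : mkseq (grid_digits b S h z) k = mkseq (grid_digits b S h x) k.
  apply: same_cell_same_word => // i; rewrite zE grid_cell_between//.
  by rewrite -!word_value_digits// same.
move: nohole; rewrite negb_exists => /forallP/(_ (grid_digits b S h z k)).
rewrite negbK -zx -mkseqS_rcons => /asboolP[e Ee]; rewrite size_mkseq => ez.
by exists e => //; apply: same_word_dist ez => //; exact: E01.
Qed.

(** Take the first [m] for which the left inequality holds. *)
Lemma scale_exists (R : realType) (L r : R) :
  2 <= L -> 0 < r -> r < 3 * L / 2 ->
  exists m : nat, 3 / L ^+ m / 2 <= r < 3 * L / L ^+ m / 2.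
Proof.
move=> L2 r0 rL; have L0 : 0 < L by lra.
have Lm m : 0 < L ^+ m by rewrite exprn_gt0.
have ex_m : exists m, 3 / L ^+ m / 2 <= r.
  pose m := (Num.truncn (3 / r)).+1; exists m.
  have lt_m : 3 / r < m%:R by exact: truncnS_gt.
  have le_L : m%:R <= L ^+ m.
    apply: (@le_trans _ _ (2 ^+ m)); last by rewrite lerXn2r ?nnegrE ?(ltW L0).
    by rewrite -natrX ler_nat ltnW// ltn_expl.
  have : 3 / L ^+ m <= r.
    rewrite ler_pdivrMr// mulrC -ler_pdivrMr//.
    by apply: le_trans le_L; exact: ltW.
  by lra.
have [m le_r min_m] := ex_minnP ex_m; exists m; rewrite le_r/=.
case: m le_r min_m => [_ _|m _ min_m]; first by rewrite expr0 divr1.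
have -> : 3 * L / L ^+ m.+1 = 3 / L ^+ m by rewrite exprS; field; rewrite !gt_eqF.
by rewrite ltNge; apply/negP => /min_m; rewrite ltnn.
Qed.

(** The grids come in two sizes; with base [L ^ 2] their cell sides together run
    through all the [3 * L / L ^+ m]. *)
Definition grid_size (R : realType) (L : nat) (p : bool) : R :=
  if p then 3 * L%:R else 3.

(** The cell side [3 * L / L ^+ m] is chosen larger than twice the distance [r], so
    that some grid has [x] and [y] in one cell, and at most [2 * L * r], so that the
    subcell side, [L ^ 2] times smaller, is at most [2 * r / L].  If the cell has a
    hole, equal colours put [x] and [y] in one subcell and [r <= d * (2 * r / L)],
    which is absurd. *)
Lemma chain_of_same_colour (R : realType) (d b L N n : nat) (delta : R)
    (E : set 'rV[R]_d) (x y : 'rV[R]_d) :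
  b.+1 = (L ^ 2)%N -> odd L -> (1 < L)%N -> (2 * d < L)%N -> (0 < N)%N ->
  N%:R^-1 < delta / 2 -> 8 * d%:R * N%:R <= delta * L%:R ->
  E `<=` unit_cube -> E x -> E y -> x <> y ->
  (forall p h, ~ exceptional b (grid_size R L p) h E n x) ->
  (forall p h, let alive := alive_word (grid_size R L p) h E in
    hole_colour alive n (grid_digits b (grid_size R L p) h x) =
    hole_colour alive n (grid_digits b (grid_size R L p) h y)) ->
  exists s, chain_from_to_in (delta * eucl_norm (x - y)) x y E s /\
    chain_length x s <= (1 + delta) * eucl_norm (x - y).
Proof.
move=> bL oddL L1 dL N0 N_delta L_delta E01 Ex Ey xy not_exc colour.
have x01 := E01 x Ex; have y01 := E01 y Ey.
set r := eucl_norm (x - y).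
have r0 : 0 < r.
  rewrite lt_def eucl_norm_ge0 andbT; apply/eqP => /eucl_norm0_eq0/eqP.
  by rewrite subr_eq0 => /eqP.
have L2 : 2 <= L%:R :> R by rewrite ler_nat.
have L0 : 0 < L%:R :> R by lra.
have dL' : 2 * d%:R < L%:R :> R by rewrite -natrM ltr_nat.
have Np : 0 < N%:R :> R by rewrite ltr0n.
have N1 : 1 <= N%:R :> R by rewrite ler1n.
have r_le_d : r <= d%:R.
  rewrite -[X in _ <= X]mulr1; apply: eucl_norm_le_sup => // i; rewrite !mxE.
  by have /andP[? ?] := x01 i; have /andP[? ?] := y01 i; rewrite ler_norml; lra.
have r_lt : r < 3 * L%:R / 2 by lra.
have [m /andP[m_le m_gt]] := scale_exists L2 r0 r_lt.
set p := ~~ odd m; set k := m./2; set S := grid_size R L p.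
have S3 : 3 <= S by rewrite /S /grid_size; case: ifP => _; lra.
have side : S / b.+1%:R ^+ k = 3 * L%:R / L%:R ^+ m.
  rewrite bL natrX -exprM /S /grid_size /p /k -[X in _ = _ / _ ^+ X]odd_double_half.
  rewrite -mul2n; case: (odd m) => //=.
  by rewrite add1n exprS; field; rewrite !gt_eqF ?exprn_gt0.
have sub_side : S / b.+1%:R ^+ k.+1 = 3 / L%:R ^+ m / L%:R.
  rewrite exprSr invfM mulrA side bL natrX.
  by field; rewrite !gt_eqF ?exprn_gt0.
have sub_side_le : S / b.+1%:R ^+ k.+1 <= 2 * r / L%:R.
  by rewrite sub_side ler_pM2r ?invr_gt0//; lra.
have sub_side_ge0 : 0 <= S / b.+1%:R ^+ k.+1.
  by rewrite divr_ge0 ?exprn_ge0//; lra.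
(* The shift is chosen independently in each coordinate. *)
have [h same_cell] : {h : {ffun 'I_d -> bool} & forall i,
    grid_cell b S (h i) k (x ord0 i) = grid_cell b S (h i) k (y ord0 i)}.
  have one_of_two i : exists c, grid_cell b S c k (x ord0 i) =
      grid_cell b S c k (y ord0 i).
    apply: grid_cell_one_of_two => //; first by rewrite bL oddX oddL orbT.
    rewrite side; apply: le_lt_trans m_gt.
    by have := coord_le_eucl_norm (x - y) i; rewrite !mxE.
  have [h hP] := choice one_of_two.
  by exists [ffun i => h i] => i; rewrite ffunE.
have same := same_cell_same_word S3 x01 y01 same_cell.
have [hole|nohole] :=
    boolP (has_hole (alive_word S h E) (mkseq (grid_digits b S h x) k)).
  have lt_n := hole_count_lt k S3 E01 Ex (not_exc p h).
  have next := hole_colour_next (colour p h) same hole lt_n.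
  have : mkseq (grid_digits b S h x) k.+1 = mkseq (grid_digits b S h y) k.+1.
    by rewrite !mkseqS_rcons same next.
  move=> /(same_word_dist S3 x01 y01); rewrite -/r => r_le.
  have : r <= d%:R * (2 * r / L%:R) by apply: le_trans r_le _; rewrite ler_wpM2l.
  rewrite mulrA ler_pdivlMr// mulrCA mulrA; nra.
set sigma := d%:R * (S / b.+1%:R ^+ k.+1).
have sigma_le : sigma * (4 * N%:R) <= delta * r.
  apply: (@le_trans _ _ (d%:R * (2 * r / L%:R) * (4 * N%:R))).
    by apply: ler_wpM2r; [rewrite mulr_ge0|rewrite ler_wpM2l].
  have -> : d%:R * (2 * r / L%:R) * (4 * N%:R) = 8 * d%:R * N%:R * r / L%:R by ring.
  by rewrite ler_pdivrMr// [leRHS]mulrAC ler_wpM2r// ltW.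
have sigma0 : 0 <= sigma by rewrite mulr_ge0.
apply: (@chain_near_segment _ _ E x y N sigma) => //.
- by move=> th th01; exact: (segment_near_set S3 E01 Ex Ey th01 same nohole).
- rewrite -/r; have : r / N%:R < r * (delta / 2) by rewrite ltr_pM2l.
  have : sigma * 4 <= sigma * (4 * N%:R) by rewrite ler_wpM2l// ler_peMr.
  lra.
- by rewrite -/r; nra.
Qed.

(** * The decomposition *)

Lemma outer_measure_bigsetU_le (R : realType) (T : Type)
    (mu : {outer_measure set T -> \bar R}) (I : Type) (s : seq I) (F : I -> set T) :
  (mu (\big[setU/set0]_(i <- s) F i) <= \sum_(i <- s) mu (F i))%E.
Proof.
elim: s => [|i s IHs]; first by rewrite !big_nil outer_measure0.
by rewrite !big_cons (le_trans (outer_measureU2 _ _ _))// leeD2l.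
Qed.

Lemma geometric_lt (R : realType) (c q e : R) :
  0 <= q < 1 -> 0 < e -> exists n, c * q ^+ n < e.
Proof.
move=> /andP[q0 q1] e0.
have cvg : (fun n => c * q ^+ n) @ \oo --> (0 : R^o).
  by apply: cvg_geometric; rewrite ger0_norm.
have /cvgr_lt/(_ e e0)[n _ lt_e] := cvg.
by exists n; apply: lt_e => /=.
Qed.

Theorem theorem1p9 (R : realType) (d : nat) (alpha delta : R)
    (alpha_gt0 : 0 < alpha) (delta_gt0 : 0 < delta) :
  exists M : nat, forall E : set 'rV[R]_d, E `<=` unit_cube ->
    exists (F : 'I_M -> set 'rV[R]_d) (Z : set 'rV[R]_d),
      [/\ (forall i, F i `<=` E) /\ Z `<=` E,
          E = (\bigcup_i F i) `|` Z,
          lebesgue_measurable E -> lebesgue_measurable Z,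
          (lebesgue_outer Z < alpha%:E)%E &
          forall i, well_connected delta (F i) E].
Proof.
(* [N] steps of length [r / N] leave room [delta * r / 2] in each step, and [L] is
   so large that displacing the [N] samples costs at most [delta * r] in length. *)
pose N := (Num.truncn (2 / delta)).+1.
have N_delta : N%:R^-1 < delta / 2.
  by rewrite -[delta / 2]invf_div ltf_pV2 ?posrE ?divr_gt0// truncnS_gt.
pose t := Num.truncn (8 * d%:R * N%:R / delta).
have t_gt : 8 * d%:R * N%:R / delta < t.+1%:R by exact: truncnS_gt.
pose L := (t + d).+1.*2.+1.
have L_delta : 8 * d%:R * N%:R <= delta * L%:R.
  rewrite [leRHS]mulrC -ler_pdivrMr//; apply: (le_trans (ltW t_gt)).
  by rewrite ler_nat /L; lia.
have L1 : (1 < L)%N by rewrite /L; lia.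
have dL : (2 * d < L)%N by rewrite /L; lia.
have oddL : odd L by rewrite /L /= odd_double.
pose b := (L ^ 2).-1; have bL : b.+1 = (L ^ 2)%N by rewrite prednK// expn_gt0.
pose A : finType := {ffun 'I_d -> 'I_b.+1}.
pose G : finType := (bool * {ffun 'I_d -> bool})%type.
pose S (g : G) := grid_size R L g.1.
have L3 : 3 <= 3 * L%:R :> R by rewrite ler_peMr// ler1n.
have S3 g : 3 <= S g by rewrite /S /grid_size; case: ifP.
have SL g : S g <= 3 * L%:R by rewrite /S /grid_size; case: ifP.
have A0 : (0 < #|A|)%N by apply/card_gt0P; exists [ffun=> ord0].
pose q : R := 1 - #|A|%:R^-1.
have q01 : 0 <= q < 1.
  by rewrite subr_ge0 invf_le1 ?ltr0n// ler1n A0 gtrBl invr_gt0 ltr0n.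
have q0 : 0 <= q by case/andP: q01.
have [n n_alpha] := geometric_lt (#|G|%:R * (3 * L%:R) ^+ d) q01 alpha_gt0.
pose C : finType := {ffun G -> {ffun 'I_n -> A}}.
exists #|C| => E E01.
pose U := \bigcup_(g : G) exceptional b (S g) g.2 E n.
pose colour (x : 'rV[R]_d) : C :=
  [ffun g => hole_colour (alive_word (S g) g.2 E) n (grid_digits b (S g) g.2 x)].
exists (fun i => [set x | [/\ E x, ~ U x & colour x = enum_val i]]), (E `&` U).
split.
- by split=> [i x []//|x []].
- apply/seteqP; split => [x Ex|x [[i _ []]|[]]//].
  have [Ux|nUx] := pselect (U x); [by right|left].
  by exists (enum_rank (colour x)) => //; split; rewrite ?enum_rankK.
- move=> mE; apply: (@caratheodory_measurable_setI R _ (@lebesgue_outer R d)) => //.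
  by apply: lebesgue_measurable_bigcup => g; exact: lebesgue_measurable_exceptional.
- apply: (@le_lt_trans _ _ (lebesgue_outer U)).
    by apply: le_lebesgue_outer; exact: subIsetr.
  apply: le_lt_trans (_ : (#|G|%:R * (3 * L%:R) ^+ d * q ^+ n)%:E < _)%E;
    last by rewrite lte_fin.
  have -> : U = \big[setU/set0]_(g <- enum G) exceptional b (S g) g.2 E n.
    rewrite -bigcup_seq; apply/seteqP; split=> x [g _ gx]; exists g => //=.
    by rewrite mem_enum.
  apply: (le_trans (@outer_measure_bigsetU_le R _ (@lebesgue_outer R d) _ _ _)).
  apply: (@le_trans _ _ (\sum_(g <- enum G) ((3 * L%:R) ^+ d * q ^+ n)%:E)%E).
    apply: lee_sum => g _; have S0 : 0 <= S g by have := S3 g; lra.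
    apply: (le_trans (lebesgue_outer_exceptional_le b g.2 E n S0)).
    rewrite lee_fin ler_wpM2r ?exprn_ge0//.
    by apply: lerXn2r; rewrite ?nnegrE ?SL ?S0 ?(le_trans S0 (SL g)).
  by rewrite sumEFin lee_fin big_const_seq count_predT -cardE iter_addr_0
    -[leLHS]mulr_natl mulrA.
- move=> i x y [Ex nUx cx] [Ey _ cy].
  have [<-|/eqP xy] := eqVneq x y.
    exists [::]; rewrite /chain_length big_ord0 subrr eucl_norm0 !mulr0; split=> //.
    by split=> // z; rewrite inE => /eqP ->.
  apply: (@chain_of_same_colour R d b L N n delta E x y) => //.
    by move=> p h exc; apply: nUx; exists (p, h).
  move=> p h /=; have := congr1 (fun c : C => c (p, h)) (etrans cx (esym cy)).
  by rewrite !ffunE.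
Qed.
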